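(* Let $P\subset\mathbb{H}$ be any two-dimensional real linear subspace (2D plane). Then $P$ can be given as $P=\operatorname{span}_{\mathbb{R}}\{a,b\}$ with orthogonal unit quaternions $a,b$ ($|a|=|b|=1$, $S(a\overline{b})=0$), where without restriction of generality $b$ is pure, i.e. $b^2=-1$. For any such $a,b$ the following hold. (1) Set $$f:=ab,\qquad g:=\overline{a}\,b .$$ Then $f^2=g^2=-1$, and $P$ is the $q_-$ plane of the split $q_\pm=\frac12(q\pm fqg)$. If $S(a)\neq 0$ and $a\notin\mathbb{R}$, the orthogonal $q_+$ plane of this split is spanned by the orthogonal unit quaternions $$c=\mu(a)\,b,\qquad d=-\mu(a)\,a .$$ If $S(a)=0$, then $f=-g=ab$ and the orthogonal $q_+$ plane has basis $\{1,f\}$. (2) Set alternatively $$f:=ab,\qquad g:=-\overline{a}\,b .$$ Then $f^2=g^2=-1$, and $P$ is the $q_+$ plane of the split $q_\pm=\frac12(q\pm fqg)$. If $S(a)\neq0$ and $a\notin\mathbb{R}$, the orthogonal $q_-$ plane of this split (which has basis $\{f+g,\,1-fg\}$) is spanned by the same orthogonal unit quaternions $c=\mu(a)b$, $d=-\mu(a)a$. If $S(a)=0$, then $f=g=ab$ and the orthogonal $q_-$ plane has basis $\{1,f\}$.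
   Context: $\mathbb{H}$ is the real quaternion algebra with units $i,j,k$. For $q=q_r+q_i i+q_j j+q_k k$: $\overline{q}=q_r-q_i i-q_j j-q_k k$ is the quaternion conjugate, $|q|=\sqrt{q\overline q}$ the norm, $S(q)=q_r$ the scalar part, $V(q)=q-q_r$ the vector part; $q$ is pure if $q_r=0$. The inner product on $\mathbb{H}\cong\mathbb{R}^4$ is $S(p\overline q)$, and $p,q$ are orthogonal iff $S(p\overline q)=0$. A quaternion $f$ satisfies $f^2=-1$ iff it is a pure unit quaternion. For $q$ with $V(q)\ne0$, $\mu(q)=V(q)/|V(q)|$ is a pure unit quaternion. For pure unit quaternions $f,g$ ($f^2=g^2=-1$, the cases $f=\pm g$ allowed), the orthogonal 2D planes split (OPS) of $q\in\mathbb{H}$ with respect to $f,g$ is $q=q_++q_-$, $q_\pm=\frac12(q\pm fqg)$. The $q_+$ plane is $\{q_+ : q\in\mathbb{H}\}$ and the $q_-$ plane is $\{q_- : q\in\mathbb{H}\}$; these are two-dimensional real subspaces of $\mathbb{H}$, orthogonal complements of each other. *)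

(* Defs.v *)
From HB Require Import structures.
From mathcomp Require Import all_boot all_order all_algebra.
From mathcomp Require Import reals.
From mathcomp Require Import ring.

Set Implicit Arguments.
Unset Strict Implicit.
Unset Printing Implicit Defensive.

Import Order.TTheory GRing.Theory Num.Theory.
Local Open Scope ring_scope.

(* qr + qi i + qj j + qk k *)
Record quat (R : Type) := Quat { qr : R; qi : R; qj : R; qk : R }.

Definition quat_row (R : realType) (q : quat R) : 'rV[R]_4 :=
  \row_(n < 4) [:: qr q; qi q; qj q; qk q]`_n.

Definition row_quat (R : realType) (v : 'rV[R]_4) : quat R :=
  Quat (v 0 (inord 0)) (v 0 (inord 1)) (v 0 (inord 2)) (v 0 (inord 3)).

Lemma quat_rowK (R : realType) : cancel (@quat_row R) (@row_quat R).
Proof. by case=> a b c d; rewrite /row_quat !mxE /= !inordK. Qed.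

Lemma row_quatK (R : realType) : cancel (@row_quat R) (@quat_row R).
Proof.
move=> v; apply/rowP => -[[|[|[|[|n]]]] hn] //; rewrite mxE /=;
  by congr (v _ _); apply/val_inj; rewrite /= inordK.
Qed.

HB.instance Definition _ (R : realType) :=
  Choice.copy (quat R) (can_type (@quat_rowK R)).

Definition quat_add (R : realType) (p q : quat R) : quat R :=
  Quat (qr p + qr q) (qi p + qi q) (qj p + qj q) (qk p + qk q).

Definition quat_opp (R : realType) (q : quat R) : quat R :=
  Quat (- qr q) (- qi q) (- qj q) (- qk q).

Lemma quat_addA (R : realType) : associative (@quat_add R).
Proof. by move=> [????] [????] [????]; rewrite /quat_add /= !addrA. Qed.

Lemma quat_addC (R : realType) : commutative (@quat_add R).
Proof. by move=> p q; rewrite /quat_add; congr Quat; rewrite addrC. Qed.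

Lemma quat_add0q (R : realType) : left_id (Quat 0 0 0 0) (@quat_add R).
Proof. by case=> a b c d; rewrite /quat_add /= !add0r. Qed.

Lemma quat_addNq (R : realType) : left_inverse (Quat 0 0 0 0) (@quat_opp R) (@quat_add R).
Proof. by case=> a b c d; rewrite /quat_add /= !addNr. Qed.

HB.instance Definition _ (R : realType) := GRing.isZmodule.Build (quat R)
  (@quat_addA R) (@quat_addC R) (@quat_add0q R) (@quat_addNq R).

(* i^2 = j^2 = k^2 = ijk = -1 *)
Definition quat_mul (R : realType) (p q : quat R) : quat R :=
  Quat (qr p * qr q - qi p * qi q - qj p * qj q - qk p * qk q)
       (qr p * qi q + qi p * qr q + qj p * qk q - qk p * qj q)
       (qr p * qj q - qi p * qk q + qj p * qr q + qk p * qi q)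
       (qr p * qk q + qi p * qj q - qj p * qi q + qk p * qr q).

Lemma quat_mulA (R : realType) : associative (@quat_mul R).
Proof. by move=> [????] [????] [????]; rewrite /quat_mul /=; congr Quat; ring. Qed.

Lemma quat_mul1q (R : realType) : left_id (Quat 1 0 0 0) (@quat_mul R).
Proof. by move=> [????]; rewrite /quat_mul /=; congr Quat; ring. Qed.

Lemma quat_mulq1 (R : realType) : right_id (Quat 1 0 0 0) (@quat_mul R).
Proof. by move=> [????]; rewrite /quat_mul /=; congr Quat; ring. Qed.

Lemma quat_mulDl (R : realType) : left_distributive (@quat_mul R) (@quat_add R).
Proof. by move=> [????] [????] [????]; rewrite /quat_mul /=; congr Quat => /=; ring. Qed.

Lemma quat_mulDr (R : realType) : right_distributive (@quat_mul R) (@quat_add R).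
Proof. by move=> [????] [????] [????]; rewrite /quat_mul /=; congr Quat => /=; ring. Qed.

Lemma quat_one_neq0 (R : realType) : Quat 1 0 0 0 != 0 :> quat R.
Proof. by apply/eqP => -[] /eqP; rewrite oner_eq0. Qed.

HB.instance Definition _ (R : realType) := GRing.Zmodule_isNzRing.Build (quat R)
  (@quat_mulA R) (@quat_mul1q R) (@quat_mulq1 R) (@quat_mulDl R) (@quat_mulDr R) (@quat_one_neq0 R).

Definition quat_scale (R : realType) (x : R) (q : quat R) : quat R :=
  Quat (x * qr q) (x * qi q) (x * qj q) (x * qk q).

Lemma quat_scaleA (R : realType) (x y : R) (q : quat R) :
  quat_scale x (quat_scale y q) = quat_scale (x * y) q.
Proof. by rewrite /quat_scale /= !mulrA. Qed.

Lemma quat_scale1q (R : realType) : left_id 1 (@quat_scale R).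
Proof. by case=> a b c d; rewrite /quat_scale /= !mul1r. Qed.

Lemma quat_scaleDr (R : realType) : right_distributive (@quat_scale R) +%R.
Proof. by move=> x p q; congr Quat; rewrite /= mulrDr. Qed.

Lemma quat_scaleDl (R : realType) (q : quat R) :
  {morph (@quat_scale R)^~ q : x y / x + y}.
Proof. by move=> x y; congr Quat; rewrite /= mulrDl. Qed.

HB.instance Definition _ (R : realType) := GRing.Zmodule_isLmodule.Build R (quat R)
  (@quat_scaleA R) (@quat_scale1q R) (@quat_scaleDr R) (@quat_scaleDl R).

Lemma quat_scaleAl (R : realType) (x : R) (p q : quat R) : x *: (p * q) = x *: p * q.
Proof. by case: p q => [????] [????]; congr Quat => /=; ring. Qed.

HB.instance Definition _ (R : realType) :=
  GRing.Lmodule_isLalgebra.Build R (quat R) (@quat_scaleAl R).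

Lemma quat_scaleAr (R : realType) (x : R) (p q : quat R) : x *: (p * q) = p * (x *: q).
Proof. by case: p q => [????] [????]; congr Quat => /=; ring. Qed.

HB.instance Definition _ (R : realType) :=
  GRing.Lalgebra_isAlgebra.Build R (quat R) (@quat_scaleAr R).

Lemma quat_vect_axiom (R : realType) : Vector.axiom 4 (quat R).
Proof.
exists (@quat_row R).
  move=> x p q; apply/rowP => -[[|[|[|[|n]]]] hn] //; by rewrite !mxE.
exists (@row_quat R); [exact: quat_rowK | exact: row_quatK].
Qed.

HB.instance Definition _ (R : realType) :=
  Lmodule_hasFinDim.Build R (quat R) (@quat_vect_axiom R).

Definition quat_conj (R : realType) (q : quat R) : quat R :=
  Quat (qr q) (- qi q) (- qj q) (- qk q).

Definition quat_S (R : realType) (q : quat R) : R := qr q.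

Definition quat_V (R : realType) (q : quat R) : quat R := q - (quat_S q)%:A.

Definition quat_pure (R : realType) (q : quat R) : Prop := quat_S q = 0.

(* q * conj q is real, by quat_mul_conj below *)
Definition quat_norm (R : realType) (q : quat R) : R :=
  Num.sqrt (quat_S (q * quat_conj q)).

Lemma quat_mul_conj (R : realType) (q : quat R) : q * quat_conj q = (quat_norm q ^+ 2)%:A.
Proof.
case: q => a b c d; rewrite sqr_sqrtr.
  by congr Quat => /=; ring.
have -> : quat_S (Quat a b c d * quat_conj (Quat a b c d))
          = a ^+ 2 + b ^+ 2 + c ^+ 2 + d ^+ 2 by rewrite /quat_S /=; ring.
by rewrite !addr_ge0 ?sqr_ge0.
Qed.

Definition quat_dot (R : realType) (p q : quat R) : R := quat_S (p * quat_conj q).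

Definition quat_orth (R : realType) (p q : quat R) : Prop := quat_dot p q = 0.

Definition quat_mu (R : realType) (q : quat R) : quat R :=
  (quat_norm (quat_V q))^-1 *: quat_V q.

Definition quat_real (R : realType) (q : quat R) : Prop :=
  exists x : R, q = x%:A.

Definition ops_plus (R : realType) (f g q : quat R) : quat R :=
  2^-1 *: (q + f * q * g).

Definition ops_minus (R : realType) (f g q : quat R) : quat R :=
  2^-1 *: (q - f * q * g).

Lemma ops_plus_linear (R : realType) (f g : quat R) : linear (ops_plus f g).
Proof.
move=> x p q; rewrite /ops_plus mulrDr mulrDl -scalerAr -scalerAl.
by rewrite addrACA -scalerDr [LHS]scalerDr !scalerA [2^-1 * x]mulrC.
Qed.

Lemma ops_minus_linear (R : realType) (f g : quat R) : linear (ops_minus f g).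
Proof.
move=> x p q; rewrite /ops_minus mulrDr mulrDl -scalerAr -scalerAl.
by rewrite opprD addrACA -scalerBr [LHS]scalerDr !scalerA [2^-1 * x]mulrC.
Qed.

HB.instance Definition _ (R : realType) (f g : quat R) :=
  GRing.isLinear.Build R (quat R) (quat R) *:%R (ops_plus f g)
    (@ops_plus_linear R f g).

HB.instance Definition _ (R : realType) (f g : quat R) :=
  GRing.isLinear.Build R (quat R) (quat R) *:%R (ops_minus f g)
    (@ops_minus_linear R f g).

Definition plus_plane (R : realType) (f g : quat R) : {vspace quat R} :=
  limg (linfun (ops_plus f g)).

Definition minus_plane (R : realType) (f g : quat R) : {vspace quat R} :=
  limg (linfun (ops_minus f g)).

Lemma plus_planeP (R : realType) (f g x : quat R) :
  x \in plus_plane f g <-> exists q, x = ops_plus f g q.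
Proof.
split=> [/memv_imgP[q _ ->]|[q ->]]; first by exists q; rewrite lfunE.
by rewrite -(lfunE (ops_plus f g)) memv_img ?memvf.
Qed.

Lemma minus_planeP (R : realType) (f g x : quat R) :
  x \in minus_plane f g <-> exists q, x = ops_minus f g q.
Proof.
split=> [/memv_imgP[q _ ->]|[q ->]]; first by exists q; rewrite lfunE.
by rewrite -(lfunE (ops_minus f g)) memv_img ?memvf.
Qed.

Definition is_orthocompl (R : realType) (U W : {vspace quat R}) : Prop :=
  forall x : quat R, x \in W <-> (forall y, y \in U -> quat_orth x y).

Definition orthounit_span (R : realType) (U : {vspace quat R}) (p q : quat R) :
    Prop :=
  [/\ quat_norm p = 1, quat_norm q = 1, quat_orth p q & U = <<[:: p; q]>>%VS].

(* Main.v *)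
Require Import Defs.
From mathcomp Require Import all_boot all_order all_algebra.
From mathcomp Require Import reals.
From mathcomp Require Import ring.
Import GRing.Theory Num.Theory.
Local Open Scope ring_scope.

(** The conditions on [a] and [b] are two commutation rules in disguise.
    Since [2 S(p conj q) = p (conj q) + q (conj p)], orthogonality of [p] to the
    pure quaternion [b] means [p b = b (conj p)].  For unit [a] and [b] this makes
    [f = a b] and [g = (conj a) b] square to [-1], and gives [f a g = - a],
    [f b g = - b], while every [x] orthogonal to both [a] and [b] satisfies
    [f x g = x] ([twist_orth]).

    When [f ^+ 2 = g ^+ 2 = -1], the map [q |-> f q g] is an involution and the
    two planes of the split are its eigenspaces for [1] and [-1].  It is
    self-adjoint, because [f] and [g] are pure, so the eigenspaces are
    orthogonal.  Subtracting from an element of the [-1] eigenspace its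
    projection onto [span a b] leaves a vector lying in both eigenspaces, hence
    zero: so the [-1] eigenspace is [P], and the [1] eigenspace is the
    orthogonal complement of [P], of dimension [4 - 2].  Two orthogonal nonzero
    vectors fixed by the involution therefore form a basis of it
    ([plus_plane_basis]), and it remains to exhibit such vectors.

    Changing the sign of [g] exchanges the two planes, so the second half of the
    theorem is the first half read again.  The pair [a], [b] itself exists
    because a plane meets the hyperplane of pure quaternions in a nonzero
    vector. *)

(** * Conjugation and inner product *)

Ltac quat_components :=
  intros; repeat match goal with q : quat _ |- _ => destruct q end;
  rewrite /quat_dot /quat_S /=.

Section Quaternions.
Variable R : realType.
Implicit Types (a b f g m p q u w x y : quat R) (s t : R) (P : {vspace quat R}).

Lemma quat_conjM p q : quat_conj (p * q) = quat_conj q * quat_conj p.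
Proof. by quat_components; congr Quat => /=; ring. Qed.

Lemma quat_conjK q : quat_conj (quat_conj q) = q.
Proof. by quat_components; rewrite /quat_conj /= !opprK. Qed.

Lemma quat_dotC p q : quat_dot p q = quat_dot q p.
Proof. by quat_components; ring. Qed.

Lemma quat_dotDl p q x : quat_dot (p + q) x = quat_dot p x + quat_dot q x.
Proof. by rewrite /quat_dot mulrDl. Qed.

Lemma quat_dotZl s p x : quat_dot (s *: p) x = s * quat_dot p x.
Proof. by rewrite /quat_dot -scalerAl. Qed.

Lemma quat_dotNl p x : quat_dot (- p) x = - quat_dot p x.
Proof. by rewrite /quat_dot mulNr. Qed.

Lemma quat_dotZr s x p : quat_dot x (s *: p) = s * quat_dot x p.
Proof. by rewrite !(quat_dotC x) quat_dotZl. Qed.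

Lemma quat_dotNr x p : quat_dot x (- p) = - quat_dot x p.
Proof. by rewrite !(quat_dotC x) quat_dotNl. Qed.

(** Left multiplication is a similarity of the Euclidean space of
    quaternions. *)
Lemma quat_dotMl m p q : quat_dot (m * p) (m * q) = quat_dot m m * quat_dot p q.
Proof. by quat_components; ring. Qed.

Lemma quat_dot_conj p q : quat_dot (quat_conj p) (quat_conj q) = quat_dot p q.
Proof. by quat_components; ring. Qed.

Lemma quat_S_real s : quat_S (s%:A : quat R) = s.
Proof. by rewrite /quat_S /= mulr1. Qed.

Lemma quat_dotqq q : quat_dot q q = quat_norm q ^+ 2.
Proof. by rewrite /quat_dot quat_mul_conj quat_S_real. Qed.

Lemma quat_dot1q q : quat_dot 1 q = quat_S q.
Proof. by rewrite /quat_dot mul1r. Qed.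

Lemma quat_norm_eq0 q : quat_norm q = 0 -> q = 0.
Proof.
move=> q0; have: quat_dot q q = 0 by rewrite quat_dotqq q0 expr0n.
case: q {q0} => x y z w; rewrite /quat_dot /quat_S /=.
have -> : x * x - y * - y - z * - z - w * - w = x ^+ 2 + y ^+ 2 + z ^+ 2 + w ^+ 2.
  by ring.
move/eqP; rewrite !paddr_eq0 ?addr_ge0 ?sqr_ge0 // !sqrf_eq0.
by case/andP=> /andP[/andP[/eqP-> /eqP->] /eqP->] /eqP->.
Qed.

Lemma quat_normE q : quat_norm q = Num.sqrt (quat_dot q q).
Proof. by []. Qed.

Lemma quat_norm_dot1 q : quat_norm q = 1 <-> quat_dot q q = 1.
Proof.
by split=> q1; [rewrite quat_dotqq q1 expr1n | rewrite quat_normE q1 sqrtr1].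
Qed.

Lemma quat_normalize q : q != 0 -> quat_norm ((quat_norm q)^-1 *: q) = 1.
Proof.
move=> q0; apply/quat_norm_dot1; rewrite quat_dotZl quat_dotZr quat_dotqq.
have n0 : quat_norm q != 0 by apply: contra_neq q0; apply: quat_norm_eq0.
by rewrite expr2 mulKf // mulVf.
Qed.

Lemma quat_unit_mul_conj q : quat_dot q q = 1 -> q * quat_conj q = 1.
Proof. by rewrite quat_mul_conj -quat_dotqq => ->; rewrite scale1r. Qed.

Lemma quat_unit_conj_mul q : quat_dot q q = 1 -> quat_conj q * q = 1.
Proof.
by move=> q1; rewrite -{2}[q]quat_conjK quat_unit_mul_conj // quat_dot_conj.
Qed.

Lemma quat_S_conj_mul p q : quat_S (quat_conj p * q) = quat_dot p q.
Proof. by quat_components; ring. Qed.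

Lemma quat_mu_pure q : quat_pure (quat_mu q).
Proof.
rewrite /quat_pure /quat_mu /quat_V; move: (quat_norm _)^-1 => s.
by quat_components; ring.
Qed.

Lemma quat_V_conj q : 2 *: quat_V q = q - quat_conj q.
Proof. by quat_components; congr Quat => /=; ring. Qed.

Lemma quat_pure_conj q : quat_pure q -> quat_conj q = - q.
Proof.
by rewrite /quat_pure /quat_S; case: q => x y z w /= ->; congr Quat; rewrite oppr0.
Qed.

Lemma quat_pure_unit_sqr q : quat_pure q -> quat_dot q q = 1 -> q ^+ 2 = -1.
Proof.
move=> /quat_pure_conj qp /quat_unit_mul_conj; rewrite qp mulrN expr2.
by move=> <-; rewrite opprK.
Qed.

(** The source of every commutation rule below: for pure [b] the symmetrised
    product [p (conj b) + b (conj p)], which equals [2 S(p conj b)], is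
    [b (conj p) - p b]. *)
Lemma quat_orth_pure_mul {p b} :
  quat_orth p b -> quat_pure b -> p * b = b * quat_conj p.
Proof.
rewrite /quat_orth => pb /quat_pure_conj bp.
have sym x y : x * quat_conj y + y * quat_conj x = (2 * quat_dot x y)%:A.
  by quat_components; congr Quat => /=; ring.
have := sym p b; rewrite pb mulr0 scale0r bp mulrN addrC.
by move/eqP; rewrite subr_eq0 => /eqP ->.
Qed.

Lemma quat_orth_pure_conj_mul {p b} :
  quat_orth p b -> quat_pure b -> quat_conj p * b = b * p.
Proof.
move=> pb bp; rewrite -{2}[p]quat_conjK; apply: quat_orth_pure_mul => //.
move: pb; rewrite /quat_orth -quat_dot_conj (quat_pure_conj _ bp) quat_dotNr.
by move/eqP; rewrite oppr_eq0 => /eqP.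
Qed.

(** * Orthogonal pairs *)

Lemma orth_pair_free p q : p != 0 -> q != 0 -> quat_orth p q -> free [:: p; q].
Proof.
move=> p0 q0 pq; rewrite free_cons span_seq1 seq1_free q0 andbT.
apply/negP => /vlineP[s ps]; move: pq; rewrite /quat_orth ps quat_dotZl.
move/eqP; rewrite mulf_eq0 => /orP[/eqP s0|]; first by rewrite ps s0 scale0r eqxx in p0.
by rewrite quat_dotqq sqrf_eq0 => /eqP/quat_norm_eq0/eqP; apply/negP.
Qed.

Lemma quat_unit_neq0 p : quat_dot p p = 1 -> p != 0.
Proof.
move=> p1; apply/eqP => p0; move/eqP: p1.
by rewrite p0 /quat_dot mul0r /quat_S /= eq_sym oner_eq0.
Qed.

Lemma plane_vector_off_line P u :
  \dim P = 2%N -> exists2 w, w \in P & forall s, w - s *: u != 0.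
Proof.
move=> dP; have : ~~ (P <= <[u]>)%VS.
  by apply/negP => /dimvS; rewrite dP dim_vline; case: (u != 0).
case/subvPn=> w wP wu; exists w => // s; apply: contra wu.
by rewrite subr_eq0 => /eqP->; apply: memvZ; apply: memv_line.
Qed.

(** The scalar part is one linear condition: a combination of two independent
    vectors of the plane cancels it. *)
Lemma plane_pure_vector P :
  \dim P = 2%N -> exists b, [/\ b \in P, b != 0 & quat_pure b].
Proof.
move=> dP; set u := vpick P.
have uP : u \in P by apply: memv_pick.
have u0 : u != 0 by rewrite vpick0 -dimv_eq0 dP.
have [Su|Su] := eqVneq (quat_S u) 0; first by exists u.
have [w wP wu] := plane_vector_off_line P u dP.
exists (w - (quat_S w / quat_S u) *: u); split; [|exact: wu|].
  by rewrite memvB ?memvZ.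
have -> s : quat_pure (w - s *: u) = (quat_S w - s * quat_S u = 0) by [].
by rewrite divfK ?subrr.
Qed.

(** A Gram-Schmidt step started at a pure vector of the plane. *)
Lemma plane_orthounit_pair P :
  \dim P = 2%N -> exists a b, orthounit_span P a b /\ quat_pure b.
Proof.
move=> dP; have [b0 [b0P b0n b0p]] := plane_pure_vector P dP.
pose b := (quat_norm b0)^-1 *: b0.
have b1 : quat_norm b = 1 by apply: quat_normalize.
have bb : quat_dot b b = 1 by apply/quat_norm_dot1.
have bP : b \in P by apply: memvZ.
have bp : quat_pure b by rewrite /quat_pure /quat_S /= -/(quat_S b0) b0p mulr0.
have [w wP wb] := plane_vector_off_line P b dP.
pose a0 := w - quat_dot w b *: b; pose a := (quat_norm a0)^-1 *: a0.
have a1 : quat_norm a = 1 by apply/quat_normalize/wb.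
have aP : a \in P by rewrite memvZ ?memvB ?memvZ.
have ab : quat_orth a b.
  by rewrite /quat_orth quat_dotZl quat_dotDl quat_dotNl quat_dotZl bb mulr1 subrr mulr0.
exists a, b; do 2!split=> //; apply/esym/eqP.
have fr : free [:: a; b].
  by apply: orth_pair_free => //; apply: quat_unit_neq0; apply/quat_norm_dot1.
rewrite eqEdim dP (eqP fr) leqnn andbT; apply/span_subvP => x.
by rewrite !inE => /orP[]/eqP->.
Qed.

(** * The planes of a split as eigenspaces *)

Lemma half_add q : 2^-1 *: (q + q) = q.
Proof.
by rewrite -mulr2n -scaler_nat scalerA mulVf ?scale1r // pnatr_eq0.
Qed.

Lemma twistK f g q : f ^+ 2 = -1 -> g ^+ 2 = -1 -> f * (f * q * g) * g = q.
Proof.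
move=> f2 g2; rewrite !mulrA -expr2 f2 -!mulrA -expr2 g2.
by rewrite mulrN1 mulN1r opprK.
Qed.

Lemma plus_plane_fixed f g x : f ^+ 2 = -1 -> g ^+ 2 = -1 ->
  x \in plus_plane f g <-> f * x * g = x.
Proof.
move=> f2 g2; rewrite plus_planeP; split=> [[q ->]|fxg].
  by rewrite /ops_plus -scalerAr -scalerAl mulrDr mulrDl twistK // addrC.
by exists x; rewrite /ops_plus fxg half_add.
Qed.

Lemma minus_planeN f g : minus_plane f (- g) = plus_plane f g.
Proof.
apply/vspaceP => x; apply/idP/idP.
  by case/minus_planeP=> q ->; apply/plus_planeP; exists q; rewrite /ops_minus mulrN opprK.
by case/plus_planeP=> q ->; apply/minus_planeP; exists q; rewrite /ops_minus mulrN opprK.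
Qed.

Lemma plus_planeN f g : plus_plane f (- g) = minus_plane f g.
Proof. by rewrite -minus_planeN opprK. Qed.

Lemma minus_plane_fixed f g x : f ^+ 2 = -1 -> g ^+ 2 = -1 ->
  x \in minus_plane f g <-> f * x * g = - x.
Proof.
move=> f2 g2; rewrite -plus_planeN plus_plane_fixed ?sqrrN // mulrN.
by split=> [fxg|->]; rewrite ?opprK // -[in RHS]fxg opprK.
Qed.

Lemma plus_minus_trivial f g x : f ^+ 2 = -1 -> g ^+ 2 = -1 ->
  x \in plus_plane f g -> x \in minus_plane f g -> x = 0.
Proof.
move=> f2 g2 /plus_plane_fixed -/(_ f2 g2) xp /minus_plane_fixed -/(_ f2 g2).
by rewrite xp => xN; rewrite -[x]half_add {2}xN subrr scaler0.
Qed.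

(** Every [q] is [q_+ + q_-], so the two eigenspaces are supplementary. *)
Lemma dim_plus_minus f g : f ^+ 2 = -1 -> g ^+ 2 = -1 ->
  (\dim (plus_plane f g) + \dim (minus_plane f g))%N = 4.
Proof.
move=> f2 g2; rewrite -dimv_disjoint_sum.
  have -> : (plus_plane f g + minus_plane f g)%VS = fullv.
    apply/eqP; rewrite eqEsubv subvf; apply/subvP => q _.
    apply/memv_addP; exists (ops_plus f g q); first by apply/plus_planeP; exists q.
    exists (ops_minus f g q); first by apply/minus_planeP; exists q.
    by rewrite -scalerDr addrACA subrr addr0 half_add.
  by rewrite dimvf.
apply/eqP; rewrite -subv0; apply/subvP => x; rewrite memv_cap memv0.
by case/andP=> xp xm; apply/eqP; apply: plus_minus_trivial xp xm.
Qed.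

(** Moving [f] and [g] across the inner product conjugates them, that is, it
    changes both signs. *)
Lemma twist_selfadjoint f g p q : quat_pure f -> quat_pure g ->
  quat_dot (f * p * g) q = quat_dot p (f * q * g).
Proof.
have adjoint u w : quat_dot (u * p * w) q = quat_dot p (quat_conj u * q * quat_conj w).
  by quat_components; ring.
by move=> /quat_pure_conj fp /quat_pure_conj gp; rewrite adjoint fp gp mulrN !mulNr opprK.
Qed.

Lemma plus_minus_orth f g x y :
  quat_pure f -> quat_pure g -> f ^+ 2 = -1 -> g ^+ 2 = -1 ->
  x \in plus_plane f g -> y \in minus_plane f g -> quat_orth x y.
Proof.
move=> fp gp f2 g2 /plus_plane_fixed -/(_ f2 g2) xp /minus_plane_fixed -/(_ f2 g2) ym.
have := twist_selfadjoint _ _ x y fp gp; rewrite xp ym quat_dotNr.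
by move/eqP; rewrite -addr_eq0 -mulr2n mulrn_eq0 => /eqP.
Qed.

(** * The split attached to an orthonormal pair *)

Section OrthonormalPair.
Variables (P : {vspace quat R}) (a b : quat R).
Hypotheses (Pab : orthounit_span P a b) (bp : quat_pure b).

Let f := a * b.
Let g := quat_conj a * b.

Let aa : quat_dot a a = 1. Proof. by case: Pab => /quat_norm_dot1. Qed.
Let bb : quat_dot b b = 1. Proof. by case: Pab => _ /quat_norm_dot1. Qed.
Let ab : quat_orth a b. Proof. by case: Pab. Qed.
Let PE : P = <<[:: a; b]>>%VS. Proof. by case: Pab. Qed.
Let aP : a \in P. Proof. by rewrite PE memv_span ?inE ?eqxx. Qed.
Let bP : b \in P. Proof. by rewrite PE memv_span ?inE ?eqxx ?orbT. Qed.
Let b2 : b * b = -1. Proof. by rewrite -expr2 quat_pure_unit_sqr. Qed.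

Lemma pair_left_pure : quat_pure f.
Proof.
rewrite /quat_pure /f -[b]opprK -(quat_pure_conj _ bp) mulrN.
have -> x : quat_S (- x) = - quat_S x by [].
by move: ab; rewrite /quat_orth /quat_dot => ->; rewrite oppr0.
Qed.

Lemma pair_right_pure : quat_pure g.
Proof.
by move: ab; rewrite /quat_pure quat_S_conj_mul.
Qed.

Lemma pair_left_sqr : f ^+ 2 = -1.
Proof.
by apply: quat_pure_unit_sqr pair_left_pure _; rewrite quat_dotMl aa bb mulr1.
Qed.

Lemma pair_right_sqr : g ^+ 2 = -1.
Proof.
apply: quat_pure_unit_sqr pair_right_pure _.
by rewrite quat_dotMl quat_dot_conj aa bb mulr1.
Qed.

Lemma twist_left : f * a * g = - a.
Proof. by rewrite /f /g -!mulrA (mulrA a (quat_conj a)) quat_unit_mul_conj // mul1r b2 mulrN1. Qed.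

Lemma twist_right : f * b * g = - b.
Proof. by rewrite /f /g -(mulrA a) b2 mulrN1 mulNr mulrA quat_unit_mul_conj // mul1r. Qed.

(** Both orthogonality conditions become ways of moving factors past [x]:
    [x b = b (conj x)] and [x (conj a) = - a (conj x)]. *)
Lemma twist_orth x : quat_orth x a -> quat_orth x b -> f * x * g = x.
Proof.
move=> xa xb.
have xbE : b * quat_conj x = x * b by rewrite (quat_orth_pure_mul xb).
have xaE : x * quat_conj a = - (a * quat_conj x).
  have : quat_conj (x * quat_conj a) = - (x * quat_conj a) by apply: quat_pure_conj.
  by rewrite quat_conjM quat_conjK => ->; rewrite opprK.
rewrite /f /g mulrA -(mulrA _ x) xaE mulrN mulNr !mulrA -(mulrA a b a).
rewrite -(quat_orth_pure_conj_mul ab bp) mulrA quat_unit_mul_conj // mul1r.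
by rewrite xbE -mulrA b2 mulrN1 opprK.
Qed.

Lemma span_minus_plane : P = minus_plane f g.
Proof.
have f2 := pair_left_sqr; have g2 := pair_right_sqr.
have aM : a \in minus_plane f g by apply/minus_plane_fixed => //; apply: twist_left.
have bM : b \in minus_plane f g by apply/minus_plane_fixed => //; apply: twist_right.
apply/vspaceP => q; apply/idP/idP; last move=> qM.
  rewrite {1}PE; apply/subvP/span_subvP => x.
  by rewrite !inE => /orP[]/eqP->.
pose x := q - (quat_dot q a *: a + quat_dot q b *: b).
have ba : quat_dot b a = 0 by rewrite quat_dotC.
have x0 : x = 0.
  apply: (plus_minus_trivial f g) => //; last by rewrite ?memvB ?memvD ?memvZ.
  apply/plus_plane_fixed => //; apply: twist_orth; rewrite /quat_orth.
    by rewrite quat_dotDl quat_dotNl quat_dotDl !quat_dotZl aa ba mulr0 mulr1 addr0 subrr.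
  by rewrite quat_dotDl quat_dotNl quat_dotDl !quat_dotZl bb ab mulr0 mulr1 add0r subrr.
by move/eqP: x0; rewrite subr_eq0 => /eqP->; rewrite memvD ?memvZ.
Qed.

Lemma plus_plane_orthocompl : is_orthocompl P (plus_plane f g).
Proof.
have f2 := pair_left_sqr; have g2 := pair_right_sqr.
move=> x; split=> [xp y|xP].
  rewrite span_minus_plane.
  by apply: plus_minus_orth => //; [apply: pair_left_pure | apply: pair_right_pure].
by apply/plus_plane_fixed => //; apply: twist_orth; apply: xP.
Qed.

Lemma plus_plane_basis p q : p != 0 -> q != 0 -> quat_orth p q ->
  f * p * g = p -> f * q * g = q -> basis_of (plus_plane f g) [:: p; q].
Proof.
have f2 := pair_left_sqr; have g2 := pair_right_sqr.
move=> p0 q0 pq pf qf; rewrite basisEfree orth_pair_free //=.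
apply/andP; split.
  by apply/span_subvP => x; rewrite !inE => /orP[]/eqP->; apply/plus_plane_fixed.
have dP : \dim P = 2%N.
  by rewrite PE; apply/eqP; apply: orth_pair_free => //; apply: quat_unit_neq0.
have := dim_plus_minus f g f2 g2; rewrite -span_minus_plane dP addn2.
by case=> ->.
Qed.

Lemma plus_plane_orthounit p q : quat_dot p p = 1 -> quat_dot q q = 1 ->
  quat_orth p q -> f * p * g = p -> f * q * g = q ->
  orthounit_span (plus_plane f g) p q.
Proof.
move=> p1 q1 pq pf qf; split=> //; try exact/quat_norm_dot1.
by apply/esym/span_basis/plus_plane_basis => //; apply: quat_unit_neq0.
Qed.

(** ** A non-real [a] *)

Section NonReal.
Hypothesis aNR : ~ quat_real a.

Let m := quat_mu a.

Let Va_neq0 : quat_V a != 0.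
Proof.
apply/eqP => /eqP; rewrite subr_eq0 => /eqP aE; apply: aNR.
by exists (quat_S a).
Qed.

Let mm : quat_dot m m = 1.
Proof. by apply/quat_norm_dot1/quat_normalize. Qed.

Let m_pure : quat_pure m. Proof. exact: quat_mu_pure. Qed.

Let m_comm : m * a = a * m.
Proof.
rewrite /m /quat_mu /quat_V -scalerAl -scalerAr mulrBl mulrBr.
by rewrite -scalerAl -scalerAr mul1r mulr1.
Qed.

Let m_orth : quat_orth m b.
Proof.
rewrite /quat_orth quat_dotZl quat_dotDl quat_dotNl quat_dotZl quat_dot1q.
by rewrite ab bp mulr0 subrr mulr0.
Qed.

Let m_anticomm : b * m = - (m * b).
Proof. by rewrite (quat_orth_pure_mul m_orth) // (quat_pure_conj _ m_pure) mulrN opprK. Qed.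

(** The axis [m] of [a] commutes with [a], being a real combination of [1] and
    [a]; it anticommutes with [b], being pure and orthogonal to [b].  Left
    multiplication by [m] therefore anticommutes with the involution and carries
    its [-1] eigenvectors to fixed vectors. *)
Lemma twist_mu x : f * x * g = - x -> f * (m * x) * g = m * x.
Proof.
have fm : f * m = - (m * f).
  by rewrite /f -mulrA m_anticomm mulrN !mulrA m_comm.
by move=> fxg; rewrite mulrA fm !mulNr -2!(mulrA m) fxg mulrN opprK.
Qed.

Lemma plus_plane_mu : orthounit_span (plus_plane f g) (m * b) (- m * a).
Proof.
apply: plus_plane_orthounit; rewrite ?mulNr.
- by rewrite quat_dotMl mm bb mulr1.
- by rewrite quat_dotNl quat_dotNr opprK quat_dotMl mm aa mulr1.
- by rewrite /quat_orth quat_dotNr quat_dotMl quat_dotC ab mulr0 oppr0.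
- exact: (twist_mu _ twist_right).
- by rewrite mulrN mulNr (twist_mu _ twist_left).
Qed.

(** These are [2 |V(a)|] times the two vectors of [plus_plane_mu]: unit length
    of [a] enters as [conj a * a = 1]. *)
Lemma plus_plane_sum_prod : basis_of (plus_plane f g) [:: f - g; 1 + f * g].
Proof.
pose s := 2 * quat_norm (quat_V a).
have n0 : quat_norm (quat_V a) != 0.
  by apply: contra_neq Va_neq0; apply: quat_norm_eq0.
have s0 : s != 0 by rewrite mulf_neq0 // pnatr_eq0.
have smE : s *: m = a - quat_conj a.
  by rewrite scalerA /s mulfK // quat_V_conj.
have -> : f - g = s *: (m * b) by rewrite scalerAl smE mulrBl.
have -> : 1 + f * g = s *: (- m * a).
  have -> : f * g = - (a * a).
    rewrite /f /g mulrA -(mulrA a b) -(quat_orth_pure_mul ab bp) mulrA.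
    by rewrite -mulrA b2 mulrN1.
  by rewrite mulNr scalerN scalerAl smE mulrBl quat_unit_conj_mul // opprB.
have [p1 q1 pq _] := plus_plane_mu.
apply: plus_plane_basis.
- by rewrite scaler_eq0 negb_or s0 quat_unit_neq0 //; apply/quat_norm_dot1.
- by rewrite scaler_eq0 negb_or s0 quat_unit_neq0 //; apply/quat_norm_dot1.
- by rewrite /quat_orth quat_dotZl quat_dotZr pq !mulr0.
- by rewrite -scalerAr -scalerAl (twist_mu _ twist_right).
- by rewrite -scalerAr -scalerAl mulNr mulrN mulNr (twist_mu _ twist_left).
Qed.

End NonReal.

(** ** A pure [a] *)

Section Pure.
Hypothesis ap : quat_pure a.

Lemma pair_pure_opp : f = - g.
Proof. by rewrite /g (quat_pure_conj _ ap) mulNr opprK. Qed.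

Lemma plus_plane_pure : basis_of (plus_plane f g) [:: 1; f].
Proof.
have f2 := pair_left_sqr; have gE : g = - f by rewrite pair_pure_opp opprK.
apply: plus_plane_basis; rewrite ?oner_eq0 //.
- by apply: quat_unit_neq0; rewrite quat_dotMl aa bb mulr1.
- by rewrite /quat_orth quat_dot1q; apply: pair_left_pure.
- by rewrite gE mulr1 mulrN -expr2 f2 opprK.
- by rewrite gE mulrN -expr2 f2 mulN1r opprK.
Qed.

End Pure.

End OrthonormalPair.
End Quaternions.

Theorem theorem3p5 (R : realType) (P : {vspace quat R}) (hP : \dim P = 2%N) :
  (exists a b : quat R, orthounit_span P a b /\ quat_pure b)
  /\
  (forall a b : quat R, orthounit_span P a b -> quat_pure b ->
    b ^+ 2 = -1
    /\
    (let f := a * b in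
     let g := quat_conj a * b in
     [/\ f ^+ 2 = -1 /\ g ^+ 2 = -1,
         P = minus_plane f g,
         is_orthocompl P (plus_plane f g),
         quat_S a <> 0 -> ~ quat_real a ->
           orthounit_span (plus_plane f g) (quat_mu a * b) (- quat_mu a * a)
       & quat_S a = 0 ->
           f = - g /\ basis_of (plus_plane f g) [:: 1; f]])
    /\
    (let f := a * b in
     let g := - quat_conj a * b in
     [/\ f ^+ 2 = -1 /\ g ^+ 2 = -1,
         P = plus_plane f g,
         is_orthocompl P (minus_plane f g),
         quat_S a <> 0 -> ~ quat_real a ->
           basis_of (minus_plane f g) [:: f + g; 1 - f * g] /\
           orthounit_span (minus_plane f g) (quat_mu a * b) (- quat_mu a * a)
       & quat_S a = 0 ->
           f = g /\ basis_of (minus_plane f g) [:: 1; f]])).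
Proof.
split; first exact: plane_orthounit_pair.
move=> a b Pab bp; have [_ /quat_norm_dot1 bb _ _] := Pab.
have f2 := pair_left_sqr R P a b Pab bp.
have g2 := pair_right_sqr R P a b Pab.
have PE := span_minus_plane R P a b Pab bp.
have Pperp := plus_plane_orthocompl R P a b Pab bp.
split; first exact: quat_pure_unit_sqr.
split; split=> //.
- by move=> _; apply: (plus_plane_mu _ _ _ _ Pab bp).
- move=> Sa; split; first exact: pair_pure_opp.
  exact: (plus_plane_pure _ _ _ _ Pab bp).
- by rewrite mulNr sqrrN.
- by rewrite mulNr plus_planeN.
- by rewrite mulNr minus_planeN.
- move=> _ aNR; rewrite mulNr mulrN opprK minus_planeN; split.
    exact: (plus_plane_sum_prod _ _ _ _ Pab bp).
  exact: (plus_plane_mu _ _ _ _ Pab bp).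
- move=> Sa; rewrite mulNr minus_planeN; split; first exact: pair_pure_opp.
  exact: (plus_plane_pure _ _ _ _ Pab bp).
Qed.
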